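(* Let $a_1,a_2\in\mathbb R[x]$ and let $\Psi_0,\Psi_1,\Psi_2\subset\mathbb R[x]$ be finite sets of polynomials in $x=(x_1,\dots,x_n)$, and let $$K=\{x\in\mathbb R^n: p(x)=0\ (p\in\Psi_0),\ q(x)\ge0\ (q\in\Psi_1),\ q(x)>0\ (q\in\Psi_2)\},$$ $$K_1=\{x\in\mathbb R^n: p(x)=0\ (p\in\Psi_0),\ q(x)\ge0\ (q\in\Psi_1\cup\Psi_2)\},$$ with $a_2>0$ on $K$. Let $d=\max\{\deg a_1,\deg a_2\}$, let $d_0=\max\{\lceil d/2\rceil,\ \lceil\deg(g)/2\rceil\ (g\in\Psi_0\cup\Psi_1\cup\Psi_2)\}$, and let $k\ge d_0$ be an integer. Assume $a_2\ge0$ on $K_1$. Suppose $y^*$ is a minimizer of the $k$th order moment relaxation $$\min\ \langle a_1,y\rangle\quad\text{s.t. } L_p^{(k)}[y]=0\ (p\in\Psi_0),\ L_q^{(k)}[y]\succeq0\ (q\in\Psi_1\cup\Psi_2),\ \langle a_2,y\rangle=1,\ M_k[y]\succeq0,\ y\in\mathbb R^{\mathbb N^n_{2k}},$$ and that $y^*$ satisfies, for some order $t\in[d_0,k]$, $$r:=\operatorname{rank}M_t[y^*]=\operatorname{rank}M_{t-d_0}[y^*].$$ Let $z_1,\dots,z_r\in K_1$ and $\mu_1,\dots,\mu_r>0$ be such that $$y^*|_{2t}=\mu_1[z_1]_{2t}+\cdots+\mu_r[z_r]_{2t}.$$ Then each $z_i$ such that $a_2(z_i)>0$ and $z_i\in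 K$ is a minimizer of the rational optimization problem $$\min\ \frac{a_1(x)}{a_2(x)}\quad\text{s.t. } x\in K.$$
   Context: $\mathbb N$ is the set of nonnegative integers and $\mathbb N^n_{m}=\{\alpha\in\mathbb N^n:\alpha_1+\cdots+\alpha_n\le m\}$. $[x]_m$ is the vector of all monomials in $x$ of degree at most $m$; $[z]_m$ is its value at a point $z$. A vector $y=(y_\alpha)_{\alpha\in\mathbb N^n_{2k}}$ is a truncated multi-sequence of degree $2k$, and $y|_{2t}$ denotes its truncation $(y_\alpha)_{\alpha\in\mathbb N^n_{2t}}$. For $f=\sum_\alpha f_\alpha x^\alpha$ of degree at most $2k$, $\langle f,y\rangle=\sum_\alpha f_\alpha y_\alpha$. For a polynomial $q$ with $\deg q\le 2k$, the $k$th order localizing matrix $L_q^{(k)}[y]$ is the symmetric matrix satisfying $\langle q a^2,y\rangle=\mathrm{vec}(a)^T L_q^{(k)}[y]\,\mathrm{vec}(a)$ for all polynomials $a$ with $\deg a\le s:=k-\lceil\deg(q)/2\rceil$, where $\mathrm{vec}(a)$ is the coefficient vector of $a$ indexed by $\mathbb N^n_s$. The moment matrix is $M_k[y]=L_1^{(k)}[y]$; for $t\le k$, $M_t[y]$ is the moment matrix formed with the truncation $y|_{2t}$. $A\succeq0$ means $A$ is symmetric positive semidefinite. (Under the displayed rank condition a decomposition of $y^*|_{2t}$ of the stated form exists.) *)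

(* Defs.v *)
From mathcomp Require Import all_boot all_order all_algebra.
From mathcomp Require Import reals.
From mathcomp Require Import mpoly.

Set Implicit Arguments.
Unset Strict Implicit.
Unset Printing Implicit Defensive.

Import Order.TTheory GRing.Theory Num.Theory.
Local Open Scope ring_scope.

Definition is_minimizer (T : Type) (R : realType) (F : T -> Prop) (f : T -> R)
    (x : T) : Prop :=
  F x /\ forall x', F x' -> f x <= f x'.

Definition psdmx (R : realType) (m : nat) (A : 'M[R]_m) : Prop :=
  A^T = A /\ forall v : 'cV[R]_m, 0 <= (v^T *m A *m v) 0 0.

(* The zero polynomial gets degree 0. *)
Definition mpdeg (R : realType) (n : nat) (p : {mpoly R[n]}) : nat :=
  (msize p).-1.

(* Truncated multi-sequences of degree e; 'X_{1..n < e.+1} is the set of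
   exponents alpha with alpha_1 + ... + alpha_n <= e; R^o (convertible to R) is what
   provides the scaling c *: y. *)
Definition tms (R : realType) (n e : nat) :=
  {ffun 'X_{1..n < e.+1} -> R^o}.

(* Meaningful for e' <= e; entries of degree larger than e are set to 0. *)
Definition truncate (R : realType) (n e e' : nat) (y : tms R n e) :
    tms R n e' :=
  [ffun m => oapp y 0 (insub (bmnm m))].

Definition monvec (R : realType) (n e : nat) (z : 'I_n -> R) : tms R n e :=
  [ffun m => 'X_[R, bmnm m].@[z]].

(* <f, y>, meaningful when f has degree at most e: the coefficients of f of
   degree larger than e are ignored. *)
Definition riesz (R : realType) (n e : nat) (f : {mpoly R[n]})
    (y : tms R n e) : R :=
  \sum_(m : 'X_{1..n < e.+1}) f@_m * y m.

Definition loc_order (R : realType) (n k : nat) (q : {mpoly R[n]}) : nat :=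
  (k - uphalf (mpdeg q))%N.

(* Size of the vectors and matrices indexed by the exponents of degree <= s,
   which are listed by [enum_val]. *)
Notation mon_count n s := #|{: 'X_{1..n < s.+1}}|.

Definition coefvec (R : realType) (n s : nat) (a : {mpoly R[n]}) :
    'cV[R]_(mon_count n s) :=
  \col_i a@_(bmnm (enum_val i)).

(* The entry (alpha, beta) is <q x^(alpha + beta), y>; [localizing_mxP] below
   shows that this is the symmetric matrix representing a |-> <q a^2, y>. *)
Definition localizing_mx (R : realType) (n k : nat) (q : {mpoly R[n]})
    (y : tms R n k.*2) : 'M[R]_(mon_count n (loc_order k q)) :=
  \matrix_(i, j)
    riesz (q * 'X_[bmnm (enum_val i)] * 'X_[bmnm (enum_val j)]) y.

Definition moment_mx (R : realType) (n k : nat) (y : tms R n k.*2) :=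
  localizing_mx 1 y.

Definition trunc_moment_mx (R : realType) (n k t : nat) (y : tms R n k.*2) :=
  moment_mx (truncate t.*2 y).

Definition semialg_K (R : realType) (n : nat)
    (Psi0 Psi1 Psi2 : seq {mpoly R[n]}) (x : 'I_n -> R) : Prop :=
  [/\ forall p, p \in Psi0 -> p.@[x] = 0,
      forall q, q \in Psi1 -> 0 <= q.@[x] &
      forall q, q \in Psi2 -> 0 < q.@[x]].

Definition semialg_K1 (R : realType) (n : nat)
    (Psi0 Psi1 Psi2 : seq {mpoly R[n]}) (x : 'I_n -> R) : Prop :=
  (forall p, p \in Psi0 -> p.@[x] = 0) /\
  (forall q, q \in Psi1 ++ Psi2 -> 0 <= q.@[x]).

Definition relax_order (R : realType) (n : nat) (a1 a2 : {mpoly R[n]})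
    (Psi0 Psi1 Psi2 : seq {mpoly R[n]}) : nat :=
  maxn (uphalf (maxn (mpdeg a1) (mpdeg a2)))
       (\max_(g <- Psi0 ++ Psi1 ++ Psi2) uphalf (mpdeg g))%N.

Definition relax_feasible (R : realType) (n k : nat) (a2 : {mpoly R[n]})
    (Psi0 Psi1 Psi2 : seq {mpoly R[n]}) (y : tms R n k.*2) : Prop :=
  [/\ forall p, p \in Psi0 -> localizing_mx p y = 0,
      forall q, q \in Psi1 ++ Psi2 -> psdmx (localizing_mx q y),
      riesz a2 y = 1 &
      psdmx (moment_mx y)].

Section LocalizingMatrix.
Variables (R : realType) (n : nat).
Implicit Types (a f q : {mpoly R[n]}).

Lemma riesz_sum e (y : tms R n e) (I : finType) (c : I -> R)
    (F : I -> {mpoly R[n]}) :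
  riesz (\sum_i c i *: F i) y = \sum_i c i * riesz (F i) y.
Proof.
rewrite /riesz; under eq_bigr => m _.
  rewrite (raddf_sum (mcoeff m)) /= mulr_suml; over.
rewrite exchange_big /=; apply: eq_bigr => i _.
by rewrite mulr_sumr; apply: eq_bigr => m _; rewrite mcoeffZ mulrA.
Qed.

Lemma mpoly_coefvec s a : (mpdeg a <= s)%N ->
  a = \sum_i coefvec s a i 0 *: 'X_[bmnm (enum_val i)].
Proof.
move=> das; have sas : (msize a <= s.+1)%N by rewrite -add1n -leq_subLR subn1.
rewrite {1}(mpolywE sas) (reindex _ (onW_bij _ (enum_val_bij _))) /=.
by apply: eq_bigr => i _; rewrite mxE.
Qed.

Lemma localizing_mx_form k q (y : tms R n k.*2) a :
  (mpdeg a <= loc_order k q)%N ->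
  riesz (q * a ^+ 2) y =
  ((coefvec _ a)^T *m localizing_mx q y *m coefvec _ a) 0 0.
Proof.
move=> das; set v := coefvec _ _.
have -> : q * a ^+ 2 = \sum_i v i 0 *: \sum_j v j 0 *:
    (q * 'X_[bmnm (enum_val i)] * 'X_[bmnm (enum_val j)]).
  rewrite expr2 mulrA {1}(mpoly_coefvec das) -/v mulr_sumr mulr_suml.
  apply: eq_bigr => i _; rewrite -scalerAr -scalerAl; congr (_ *: _).
  rewrite (mpoly_coefvec das) -/v mulr_sumr.
  by apply: eq_bigr => j _; rewrite -scalerAr.
rewrite riesz_sum -mulmxA mxE; apply: eq_bigr => i _.
rewrite riesz_sum !mxE; congr (_ * _).
by apply: eq_bigr => j _; rewrite !mxE mulrC.
Qed.

Lemma localizing_mx_sym k q (y : tms R n k.*2) :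
  (localizing_mx q y)^T = localizing_mx q y.
Proof. by apply/matrixP => i j; rewrite !mxE mulrAC. Qed.

Lemma coefvec_surj s (v : 'cV[R]_(mon_count n s)) :
  exists2 a, (mpdeg a <= s)%N & coefvec s a = v.
Proof.
exists (\sum_i v i 0 *: 'X_[bmnm (enum_val i)]).
  rewrite /mpdeg -subn1 leq_subLR add1n.
  apply: leq_trans (mmeasure_sum _ _ _ _) _.
  apply/bigmax_leqP => i _; apply: (leq_trans (msizeZ_le _ _)).
  by rewrite msizeX; exact: bmdeg.
apply/colP => i; rewrite mxE (raddf_sum (mcoeff _)) /= (bigD1 i) //= big1.
  by rewrite mcoeffZ mcoeffX eqxx mulr1 addr0.
move=> j ji; rewrite mcoeffZ mcoeffX; case: eqP => [e|]; last by rewrite mulr0.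
by case/eqP: ji; apply/enum_val_inj/val_inj.
Qed.

Lemma localizing_mxP k q (y : tms R n k.*2)
    (L : 'M[R]_(mon_count n (loc_order k q))) :
  (L^T = L /\ forall a, (mpdeg a <= loc_order k q)%N ->
     riesz (q * a ^+ 2) y = ((coefvec _ a)^T *m L *m coefvec _ a) 0 0)
  <-> L = localizing_mx q y.
Proof.
split=> [[Lsym Lform]|->]; last first.
  by split; [exact: localizing_mx_sym|exact: localizing_mx_form].
pose D := L - localizing_mx q y.
have Dsym : D^T = D by rewrite linearB /= Lsym localizing_mx_sym.
have D0 (v : 'cV_(mon_count n (loc_order k q))) : v^T *m D *m v = 0.
  have [a das <-] := coefvec_surj v.
  rewrite mulmxBr mulmxBl; apply/matrixP => i j; rewrite !ord1.
  rewrite mxE [X in _ + X]mxE -Lform // -localizing_mx_form //.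
  by rewrite subrr mxE.
apply/eqP; rewrite -subr_eq0 -/D; move: D Dsym D0 => D Dsym D0.
apply/eqP/matrixP => i j; rewrite mxE.
pose e l : 'cV[R]_(mon_count n (loc_order k q)) := delta_mx l 0.
have eDe l m : (e l)^T *m D *m e m = (D l m)%:M.
  by rewrite trmx_delta -rowE -colE; apply/matrixP => a b; rewrite !ord1 !mxE.
have := D0 (e i + e j); rewrite [(_ + _)^T]linearD /= !mulmxDr !mulmxDl !D0.
rewrite add0r addr0 !eDe => /matrixP/(_ 0 0); rewrite !mxE eqxx !mulr1n.
have -> : D j i = D i j by rewrite -[in LHS]Dsym mxE.
by move/eqP; rewrite -mulr2n mulrn_eq0 => /eqP.
Qed.
End LocalizingMatrix.

(* Main.v *)
(** Averaging the minimizer [y] with the moments of a point [w] of [K_1] gives the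
    feasible sequence [(y + [w]) / (1 + a2(w))], so minimality of [y] yields
    [c a2(w) <= a1(w)] on all of [K_1], where [c = <a1, y>]; points with
    [a2(w) = 0] need no separate argument.  In the decomposition of [y] the
    weighted sum of the nonnegative numbers [a1(z_i) - c a2(z_i)] is [c - c = 0],
    so [a1(z_i) / a2(z_i) = c] as soon as [a2(z_i) > 0], while [c] is a lower
    bound of [a1 / a2] on [K]. *)
Require Import Defs.
From mathcomp Require Import all_boot all_order all_algebra.
From mathcomp Require Import reals.
From mathcomp Require Import mpoly.
From mathcomp Require Import zify.

Set Implicit Arguments.
Unset Strict Implicit.
Unset Printing Implicit Defensive.

Import Order.TTheory GRing.Theory Num.Theory.
Local Open Scope ring_scope.

Section RieszFunctional.
Variables (R : realType) (n : nat).
Implicit Types (f g q a b : {mpoly R[n]}) (w : 'I_n -> R).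

Lemma mpdeg_le f e : (mpdeg f <= e)%N = (msize f <= e.+1)%N.
Proof. by rewrite /mpdeg -subn1 leq_subLR add1n. Qed.

(** Equality can fail: the zero polynomial gets degree 0, so a zero factor lowers the left side
    only. *)
Lemma mpdegM_le f g : (mpdeg (f * g) <= mpdeg f + mpdeg g)%N.
Proof.
rewrite /mpdeg; have [->|f0] := eqVneq f 0; first by rewrite mul0r msize0.
have [->|g0] := eqVneq g 0; first by rewrite mulr0 msize0.
by rewrite msizeM // (mpolySpred _ f0) (mpolySpred _ g0) addnS.
Qed.

Lemma mpdegX (m : 'X_{1..n}) : mpdeg 'X_[R, m] = mdeg m.
Proof. by rewrite /mpdeg msizeX. Qed.

(** When [m] has degree above [e], [insub] fails and both sides are 0. This is the default that
    [truncate] uses, so [riesz] and [truncate] agree monomial by monomial. *)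
Lemma rieszX e (y : tms R n e) (m : 'X_{1..n}) :
  riesz 'X_[m] y = oapp y 0 (insub m).
Proof.
rewrite /riesz; case: insubP => [u _ um|mNe] /=.
  rewrite (bigD1 u) //= big1 ?addr0 => [|v vu].
    by rewrite mcoeffX -um eqxx mul1r.
  rewrite mcoeffX -um; case: eqP => [/val_inj vu'|_]; last by rewrite mul0r.
  by rewrite vu' eqxx in vu.
rewrite big1 // => v _; rewrite mcoeffX; case: eqP => [mv|_]; last by rewrite mul0r.
by rewrite mv bmdeg in mNe.
Qed.

Lemma riesz_truncate e e' f (y : tms R n e) :
  (mpdeg f <= e')%N -> riesz f (truncate e' y) = riesz f y.
Proof.
rewrite mpdeg_le => df; rewrite [in RHS](mpolywE df) riesz_sum.
by apply: eq_bigr => m _; rewrite rieszX ffunE.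
Qed.

Lemma riesz_monvec e f w :
  (mpdeg f <= e)%N -> riesz f (monvec e w) = f.@[w].
Proof.
rewrite mpdeg_le => df; rewrite [in RHS](mpolywE df) raddf_sum /=.
by apply: eq_bigr => m _; rewrite ffunE mevalZ.
Qed.

Lemma rieszDr e f (y y' : tms R n e) : riesz f (y + y') = riesz f y + riesz f y'.
Proof.
by rewrite /riesz -big_split; apply: eq_bigr => m _; rewrite ffunE mulrDr.
Qed.

Lemma rieszZr e f c (y : tms R n e) : riesz f (c *: y) = c * riesz f y.
Proof.
by rewrite /riesz mulr_sumr; apply: eq_bigr => m _; rewrite ffunE mulrCA.
Qed.

Lemma riesz_sumr e f (I : finType) (c : I -> R) (y : I -> tms R n e) :
  riesz f (\sum_i c i *: y i) = \sum_i c i * riesz f (y i).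
Proof.
rewrite /riesz; under [RHS]eq_bigr => i _ do rewrite mulr_sumr.
rewrite [RHS]exchange_big; apply: eq_bigr => m _.
by rewrite sum_ffunE mulr_sumr; apply: eq_bigr => i _; rewrite ffunE mulrCA.
Qed.

Lemma localizing_mxZD k q c (y y' : tms R n k.*2) :
  localizing_mx q (c *: (y + y')) =
  c *: (localizing_mx q y + localizing_mx q y').
Proof. by apply/matrixP => i j; rewrite !mxE rieszZr rieszDr. Qed.

Lemma psdmxZD m c (A B : 'M[R]_m) :
  0 <= c -> psdmx A -> psdmx B -> psdmx (c *: (A + B)).
Proof.
move=> c0 [Asym Apos] [Bsym Bpos]; split=> [|v].
  by rewrite linearZ linearD /= Asym Bsym.
rewrite -scalemxAr -scalemxAl mulmxDr mulmxDl !mxE.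
by apply: mulr_ge0 => //; have := addr_ge0 (Apos v) (Bpos v); rewrite !mxE.
Qed.

(** With s = k - ceil(deg q / 2), deg q + 2s is at most 2k; the first hypothesis keeps the natural
    subtraction in s from being cut off at 0. Hence [riesz] loses no coefficient of such a
    product. *)
Lemma mpdeg_localizing k q a b : (uphalf (mpdeg q) <= k)%N ->
  (mpdeg a <= loc_order k q)%N -> (mpdeg b <= loc_order k q)%N ->
  (mpdeg (q * a * b) <= k.*2)%N.
Proof.
rewrite /loc_order => qk da db.
have := mpdegM_le (q * a) b; have := mpdegM_le q a; lia.
Qed.

Lemma localizing_mx_monvec_eq0 k q w : (uphalf (mpdeg q) <= k)%N ->
  q.@[w] = 0 -> localizing_mx q (monvec k.*2 w) = 0.
Proof.
(* The entry at exponents alpha, beta is q(w) w^(alpha + beta). *)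
move=> qk q0; apply/matrixP => i j; rewrite !mxE riesz_monvec.
  by rewrite !mevalM q0 !mul0r.
by apply: mpdeg_localizing => //; rewrite mpdegX -ltnS; exact: bmdeg.
Qed.

Lemma localizing_mx_monvec_psd k q w : (uphalf (mpdeg q) <= k)%N ->
  0 <= q.@[w] -> psdmx (localizing_mx q (monvec k.*2 w)).
Proof.
move=> qk q0; split=> [|v]; first exact: localizing_mx_sym.
(* Reading [v] as the coefficients of a polynomial [a] turns the quadratic form into q(w) a(w)^2. *)
have [a da <-] := coefvec_surj v.
rewrite -localizing_mx_form // riesz_monvec.
  by rewrite mevalM rmorphXn mulr_ge0 // sqr_ge0.
by rewrite expr2 mulrA mpdeg_localizing.
Qed.

End RieszFunctional.

Section Relaxation.
Variables (R : realType) (n : nat) (a1 a2 : {mpoly R[n]}).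
Variables (Psi0 Psi1 Psi2 : seq {mpoly R[n]}).
Local Notation d0 := (relax_order a1 a2 Psi0 Psi1 Psi2).

(** A degree d satisfies d <= 2 ceil(d / 2), so [riesz] at order [e] sees the whole objective. *)
Lemma relax_order_mpdeg1 e : (d0 <= e)%N -> (mpdeg a1 <= e.*2)%N.
Proof. rewrite /relax_order; lia. Qed.

Lemma relax_order_mpdeg2 e : (d0 <= e)%N -> (mpdeg a2 <= e.*2)%N.
Proof. rewrite /relax_order; lia. Qed.

Lemma relax_order_constraint e g : (d0 <= e)%N ->
  g \in Psi0 ++ Psi1 ++ Psi2 -> (uphalf (mpdeg g) <= e)%N.
Proof.
rewrite /relax_order geq_max => /andP[_ le_e] gPsi; apply: leq_trans le_e.
by rewrite (big_rem g gPsi) /= leq_maxl.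
Qed.

(** The matrix constraints are stable under sums and nonnegative scaling, and both summands satisfy
    them. Only the normalization fixes the factor: the sum has [a2]-value 1 + a2(w). *)
Lemma relax_feasible_average k (y : tms R n k.*2) w :
  (d0 <= k)%N -> relax_feasible a2 Psi0 Psi1 Psi2 y ->
  semialg_K1 Psi0 Psi1 Psi2 w -> 0 <= a2.@[w] ->
  relax_feasible a2 Psi0 Psi1 Psi2
    ((1 + a2.@[w])^-1 *: (y + monvec k.*2 w)).
Proof.
move=> d0k [Ly0 Lypos a2y My] [w0 wpos] a2w.
have c_gt0 : 0 < 1 + a2.@[w] by rewrite ltr_wpDr.
have c_ge0 : 0 <= (1 + a2.@[w])^-1 by rewrite invr_ge0 ltW.
split=> [p pPsi|q qPsi||].
- rewrite localizing_mxZD Ly0 // localizing_mx_monvec_eq0 ?addr0 ?scaler0 //.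
    by apply: relax_order_constraint; rewrite // mem_cat pPsi.
  exact: w0.
- rewrite localizing_mxZD; apply: psdmxZD => //; first exact: Lypos.
  apply: localizing_mx_monvec_psd; last exact: wpos.
  by apply: relax_order_constraint; rewrite // mem_cat qPsi orbT.
- rewrite rieszZr rieszDr a2y riesz_monvec ?relax_order_mpdeg2 //.
  by rewrite mulVf // gt_eqF.
(* The moment matrix is the localizing matrix of the constant 1, which is nonnegative at [w]. *)
- rewrite /moment_mx localizing_mxZD; apply: psdmxZD => //.
  by apply: localizing_mx_monvec_psd; rewrite ?meval1 // /mpdeg msize1.
Qed.

Lemma relax_min_lower_bound k (y : tms R n k.*2) w :
  (d0 <= k)%N ->
  is_minimizer (relax_feasible a2 Psi0 Psi1 Psi2)
    (fun y' : tms R n k.*2 => riesz a1 y') y ->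
  semialg_K1 Psi0 Psi1 Psi2 w -> 0 <= a2.@[w] ->
  riesz a1 y * a2.@[w] <= a1.@[w].
Proof.
move=> d0k [yfeas ymin] wK1 a2w.
have c_gt0 : 0 < 1 + a2.@[w] by rewrite ltr_wpDr.
(* Minimality reads c <= (c + a1(w)) / (1 + a2(w)) with c = <a1, y>; clear the denominator and
   cancel c. *)
have := ymin _ (relax_feasible_average d0k yfeas wK1 a2w).
rewrite rieszZr rieszDr riesz_monvec ?relax_order_mpdeg1 //.
by rewrite mulrC ler_pdivlMr // mulrDr mulr1 lerD2l.
Qed.

End Relaxation.

Theorem theorem5p2 (R : realType) (n : nat) (a1 a2 : {mpoly R[n]})
    (Psi0 Psi1 Psi2 : seq {mpoly R[n]})
    (a2_gt0 : forall x, semialg_K Psi0 Psi1 Psi2 x -> 0 < a2.@[x])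
    (k : nat)
    (d0_le_k : (relax_order a1 a2 Psi0 Psi1 Psi2 <= k)%N)
    (a2_ge0 : forall x, semialg_K1 Psi0 Psi1 Psi2 x -> 0 <= a2.@[x])
    (y : tms R n k.*2)
    (y_min : is_minimizer (relax_feasible a2 Psi0 Psi1 Psi2)
               (fun y' : tms R n k.*2 => riesz a1 y') y)
    (t : nat)
    (t_range : (relax_order a1 a2 Psi0 Psi1 Psi2 <= t <= k)%N)
    (r : nat)
    (rank_t : \rank (trunc_moment_mx t y) = r)
    (rank_t_d0 :
       \rank (trunc_moment_mx (t - relax_order a1 a2 Psi0 Psi1 Psi2) y) = r)
    (z : 'I_r -> 'I_n -> R) (mu : 'I_r -> R)
    (z_K1 : forall i, semialg_K1 Psi0 Psi1 Psi2 (z i))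
    (mu_gt0 : forall i, 0 < mu i)
    (y_decomp :
       truncate t.*2 y = \sum_(i < r) mu i *: monvec t.*2 (z i)) :
  forall i, 0 < a2.@[z i] -> semialg_K Psi0 Psi1 Psi2 (z i) ->
    is_minimizer (semialg_K Psi0 Psi1 Psi2)
      (fun x => a1.@[x] / a2.@[x]) (z i).
Proof.
move=> i a2zi ziK; have [[_ _ a2y _] _] := y_min.
have [d0t _] := andP t_range.
pose c := riesz a1 y.
have lower w : semialg_K1 Psi0 Psi1 Psi2 w -> 0 <= a1.@[w] - c * a2.@[w].
  by move=> wK1; rewrite subr_ge0 (relax_min_lower_bound d0_le_k) // a2_ge0.
(* The decomposition is known only for the truncation, which suffices for polynomials of degree at
   most 2t. *)
have riesz_decomp f : (mpdeg f <= t.*2)%N ->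
    riesz f y = \sum_j mu j * f.@[z j].
  move=> df; rewrite -(riesz_truncate _ df) y_decomp riesz_sumr.
  by apply: eq_bigr => j _; rewrite riesz_monvec.
have sum0 : \sum_j mu j * (a1.@[z j] - c * a2.@[z j]) = 0.
  under eq_bigr => j _ do rewrite mulrBr mulrCA.
  rewrite sumrB -mulr_sumr -!riesz_decomp ?a2y ?mulr1 ?subrr //.
    exact: relax_order_mpdeg2 d0t.
  exact: relax_order_mpdeg1 d0t.
have a1zi : a1.@[z i] = c * a2.@[z i].
  (* A zero sum of nonnegative terms has only zero terms, and [mu i] can be cancelled as it is
     positive. *)
  have /psumr_eq0P/(_ sum0 i isT)/eqP : forall j, true ->
      0 <= mu j * (a1.@[z j] - c * a2.@[z j]).
    by move=> j _; apply: mulr_ge0; [exact: ltW | exact: lower].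
  by rewrite mulf_eq0 gt_eqF //= subr_eq0 => /eqP.
split=> // x xK; rewrite a1zi mulfK ?gt_eqF // ler_pdivlMr ?a2_gt0 //.
(* What remains is c a2(x) <= a1(x), which holds because K lies in K_1. *)
rewrite -subr_ge0; apply: lower; case: xK => x0 x1 x2; split=> // q.
by rewrite mem_cat => /orP[/x1//|/x2/ltW].
Qed.
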